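(* Let $m\ge 2$ and $n\ge 3m$. Then $\sigma(C_{2m+1},n)=m(2n-m-1)+2$, and $\sigma(C_{2m+2},n)\le m(2n-m-1)+2m+2$.
   Context: A sequence $S=(d_1,\dots,d_n)$ of non-negative integers is graphical if there is a simple graph on $n$ vertices $v_1,\dots,v_n$ with $d(v_i)=d_i$; such a graph is a realization of $S$. $S$ is potentially $H$-graphical if some realization of $S$ contains $H$ as a subgraph. $\sigma(S)=d_1+\cdots+d_n$. For a graph $H$, $\sigma(H,n)$ is the smallest even integer $l$ such that every $n$-term graphical sequence $S$ with $\sigma(S)\ge l$ is potentially $H$-graphical. $C_k$ denotes the cycle on $k$ vertices. *)

(* Defs.v *)
From mathcomp Require Import all_boot.

Set Implicit Arguments.
Unset Strict Implicit.
Unset Printing Implicit Defensive.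

Record sgraph (T : finType) := SGraph {
  adj :> rel T;
  adj_sym : symmetric adj;
  adj_irr : irreflexive adj
}.

Definition degree (T : finType) (G : sgraph T) (x : T) : nat :=
  #|[set y | G x y]|.

(* Not necessarily induced *)
Definition contains_subgraph (U T : finType) (H : sgraph U) (G : sgraph T) :
    Prop :=
  exists2 f : U -> T, injective f & forall x y : U, H x y -> G (f x) (f y).

Definition realization (n : nat) (S : n.-tuple nat) (G : sgraph 'I_n) : Prop :=
  forall i : 'I_n, degree G i = tnth S i.

Definition graphical (n : nat) (S : n.-tuple nat) : Prop :=
  exists G : sgraph 'I_n, realization S G.

Definition potentially_graphical (U : finType) (H : sgraph U) (n : nat)
    (S : n.-tuple nat) : Prop :=
  exists2 G : sgraph 'I_n, realization S G & contains_subgraph H G.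

Definition degree_sum (n : nat) (S : n.-tuple nat) : nat :=
  \sum_(i < n) tnth S i.

Definition sigma_bound (U : finType) (H : sgraph U) (n l : nat) : Prop :=
  forall S : n.-tuple nat,
    graphical S -> l <= degree_sum S -> potentially_graphical H S.

(* is_sigma H n l says that sigma(H, n) = l.  Taking l in nat loses nothing when
   H has an edge and n > 0: the zero sequence then rules out every l <= 0. *)
Definition is_sigma (U : finType) (H : sgraph U) (n l : nat) : Prop :=
  [/\ ~~ odd l, sigma_bound H n l &
      forall l' : nat, ~~ odd l' -> sigma_bound H n l' -> l <= l'].

(* The conjunct i != j only matters for k = 1; this is the usual cycle C_k for
   k >= 3. *)
Definition cycle_rel (k : nat) : rel 'I_k :=
  fun i j => (i != j) && ((j == ordS i) || (i == ordS j)).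

Lemma cycle_rel_sym (k : nat) : symmetric (@cycle_rel k).
Proof. by move=> i j; rewrite /cycle_rel eq_sym orbC. Qed.

Lemma cycle_rel_irr (k : nat) : irreflexive (@cycle_rel k).
Proof. by move=> i; rewrite /cycle_rel eqxx. Qed.

Definition cycle_graph (k : nat) : sgraph 'I_k :=
  SGraph (@cycle_rel_sym k) (@cycle_rel_irr k).

Lemma is_sigma_unique (U : finType) (H : sgraph U) (n l1 l2 : nat) :
  is_sigma H n l1 -> is_sigma H n l2 -> l1 = l2.
Proof.
move=> [e1 b1 m1] [e2 b2 m2].
by apply/eqP; rewrite eqn_leq m1 // m2.
Qed.

(* Main.v *)
(* The lower bounds come from the join of K_m with an independent set: its
   degree sequence has a unique realization, and m vertices cannot cover the
   edges of C_{2m+1}.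

   For the upper bounds, an r-cycle p is turned into an (r+1)-cycle by degree
   preserving switches ab, cd -> ac, bd.  If this is impossible for every graph
   reachable by switches, then a vertex x of p adjacent to an outside vertex u
   is adjacent to all other neighbours of u, the neighbours of u on p are
   pairwise non-consecutive, and their successors are independent.  If moreover
   two outside vertices are adjacent, then (after minimizing the number of edges
   outside p) all non-isolated outside vertices have the same set I of
   neighbours on p, consecutive elements of I are at distance at least 3, and
   every chord of p meets I.  This contradicts a minimum degree m + 1, and for
   n = 3m it also contradicts the degree sum.  Otherwise n > 3m and a vertex of
   degree at most m is dropped, which lowers the threshold by 2m.  Induction on m
   supplies the cycles of length 2m, starting from triangles and C_4. *)

Require Import Defs.
From mathcomp Require Import all_boot zify.
From Stdlib Require Import Classical_Prop.

Set Implicit Arguments.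
Unset Strict Implicit.
Unset Printing Implicit Defensive.

(** * Arithmetic of the counting bounds *)

(** Trades a truncated difference for a variable with an additive equation, so that [nia] meets no
    subtraction inside a product. *)
Lemma leq_sub_ex (a b : nat) : b <= a -> exists2 c, a - b = c & a = b + c.
Proof. by move=> ab; exists (a - b) => //; lia. Qed.

(* The left side bounds the degree sum when n = 3m, the cycle has length 2m + e,
   no edge lies outside it, and i is the largest number of neighbours on the
   cycle of an outside vertex. *)
Lemma independent_outside_bound m e i : 1 < m -> e <= 1 -> i <= m ->
  i * (2 * m + e - i) + (2 * m + e - i) * (2 * m + e - 1) + (m - e) * (2 * i) <=
    m * (5 * m - 1) + 2 * m * e.
Proof.
move=> m2 e1 im.
have [a -> Ea] : exists2 a, 2 * m + e - i = a & 2 * m + e = i + a by apply: leq_sub_ex; lia.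
have [b -> Eb] : exists2 b, 2 * m + e - 1 = b & 2 * m + e = 1 + b by apply: leq_sub_ex; lia.
have [c -> Ec] : exists2 c, m - e = c & m = e + c by apply: leq_sub_ex; lia.
have [d -> Ed] : exists2 d, 5 * m - 1 = d & 5 * m = 1 + d by apply: leq_sub_ex; lia.
have [f _ Ef] : exists2 f, m - i = f & m = i + f by apply: leq_sub_ex; lia.
have [E|E] : e = 0 \/ e = 1 by lia.
  subst e m; have -> : a = i + 2 * f by lia.
  have -> : c = i + f by lia.
  nia.
subst e; have -> : a = m + f + 1 by lia.
have -> : b = 2 * m by lia.
have : i = m - f by lia.
have Hf : f = 0 \/ exists g, f = g + 1 by case: (f) => [|g]; [left|right; exists g; lia].
case: Hf Ef => [->|[g ->]] Ef; subst m; first by nia.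
have -> : c = i + g by lia.
nia.
Qed.

(** With [2 * m + e = 3 * i + f], the next count reduces to four quadratic inequalities: the first
    two when the maximum is [2 * i + (m - e) - 1], the last two when it is [2 * m]; each pair treats
    [e = 0], then [e = 1]. *)
Lemma quad_bound1 i f : 4 <= 3 * i + f -> i + 2 * f <= i * i + 3 * (i * f) + f * f.
Proof. case: i => [|i] h; [|case: f h => [|f] h]; nia. Qed.

Lemma quad_bound2 i f : 5 <= 3 * i + f -> 2 * f + 3 <= i * i + 3 * (i * f) + f * f + 2 * i.
Proof. case: i => [|i] h; [|case: f h => [|f] h]; nia. Qed.

Lemma quad_bound3 m i f : 1 < m -> 2 * m = 3 * i + f -> 10 * i + 10 * f <= 7 * (i * i) + 10 * (i * f) + 3 * (f * f).
Proof. case: i => [|[|i]] h e; nia. Qed.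

Lemma quad_bound4 i f : 5 <= 3 * i + f -> 4 * i + 8 * f + 3 <= 7 * (i * i) + 10 * (i * f) + 3 * (f * f).
Proof. case: i => [|i] h; nia. Qed.

(* Same count when there is an edge outside the cycle; k bounds the contribution
   2 deg_C + deg_O of an outside vertex. *)
Lemma outside_edge_bound m e i k : 1 < m -> e <= 1 -> 3 * i <= 2 * m + e ->
  k <= maxn (2 * i + (m - e) - 1) (2 * m) ->
  i * (2 * m + e - 1) + (2 * m + e - i) * (i + 2) + (m - e) * k <=
    m * (5 * m - 1) + 2 * m * e + 2 * i.
Proof.
move=> m2 e1 im hk.
have [a -> Ea] : exists2 a, 2 * m + e - i = a & 2 * m + e = i + a by apply: leq_sub_ex; lia.
have [b -> Eb] : exists2 b, 2 * m + e - 1 = b & 2 * m + e = 1 + b by apply: leq_sub_ex; lia.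
have [c Ec' Ec] : exists2 c, m - e = c & m = e + c by apply: leq_sub_ex; lia.
have [d -> Ed] : exists2 d, 5 * m - 1 = d & 5 * m = 1 + d by apply: leq_sub_ex; lia.
have [f Ef] : exists f, 2 * m + e = 3 * i + f by exists (2 * m + e - 3 * i); lia.
have [g Eg' Eg] : exists2 g, 2 * i + (m - e) - 1 = g & 2 * i + (m - e) = 1 + g by apply: leq_sub_ex; lia.
rewrite Eg' {Eg'} Ec' {Ec'} in hk Eg *.
apply: (@leq_trans (i * b + a * (i + 2) + c * maxn g (2 * m))).
  by rewrite leq_add2l leq_mul2l hk orbT.
have sq : (2 * m + e) * (2 * m + e) = (3 * i + f) * (3 * i + f) by rewrite Ef.
have pr : i * (2 * m + e) = i * (3 * i + f) by rewrite Ef.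
have bE : i * (2 * m + e) = i * (1 + b) by rewrite Eb.
have dE : m * (5 * m) = m * (1 + d) by rewrite Ed.
have gE : c * (2 * i + c) = c * (1 + g) by rewrite Eg.
have aE : a = 2 * i + f by lia.
have [E|E] : e = 0 \/ e = 1 by lia.
  have cE : c = m by lia.
  subst e c a.
  have h1 : i + 2 * f <= i * i + 3 * (i * f) + f * f by apply: quad_bound1; lia.
  have h3 : 10 * i + 10 * f <= 7 * (i * i) + 10 * (i * f) + 3 * (f * f) by apply: (@quad_bound3 m); lia.
  by case: (leqP g (2 * m)) => _; lia.
have mE : m = c + 1 by lia.
have h2 : 2 * f + 3 <= i * i + 3 * (i * f) + f * f + 2 * i by apply: quad_bound2; lia.
have h4 : 4 * i + 8 * f + 3 <= 7 * (i * i) + 10 * (i * f) + 3 * (f * f) by apply: quad_bound4; lia.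
subst e a m.
by case: (leqP g (2 * (c + 1))) => _; lia.
Qed.

(** * Degree-preserving switches inside a vertex set *)

Section Graphs.
Variable T : finType.
Implicit Types (G : sgraph T) (V : {set T}) (a b c d u w x y z : T).

Definition deg_in G V x := #|[set y in V | G x y]|.

(* Edges leaving V are frozen, so that deleting a vertex amounts to shrinking V:
   a switch inside the smaller set is a switch of the whole graph. *)
Definition sim V G' G :=
  (forall x, degree G' x = degree G x) /\
  (forall x y, x \notin V -> G' x y = G x y).

Lemma sim_refl V G : sim V G G.
Proof. by []. Qed.

Lemma sim_trans V G1 G2 G3 : sim V G1 G2 -> sim V G2 G3 -> sim V G1 G3.
Proof.
by move=> [d1 e1] [d2 e2]; split=> [x|x y xV]; [rewrite d1 d2 | rewrite e1 ?e2].
Qed.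

Lemma sim_sub V (W : {set T}) G' G : W \subset V -> sim W G' G -> sim V G' G.
Proof.
move=> sWV [dG eG]; split=> // x y xV; apply: eG.
by apply: contra xV; apply: (subsetP sWV).
Qed.

(** Pairs leaving [V] are frozen, so the number of neighbours outside [V] does not change, and
    neither does the total degree. *)
Lemma sim_deg_in V G' G x : sim V G' G -> deg_in G' V x = deg_in G V x.
Proof.
case=> dG eG; have dE H : degree H x = deg_in H V x + deg_in H (~: V) x.
  rewrite /degree /deg_in -cardsUI [X in _ = _ + X](_ : _ = 0) ?addn0.
    by apply: eq_card => y; rewrite !inE; case: (y \in V); rewrite ?orbF.
  by apply/eqP; rewrite cards_eq0; apply/eqP/setP=> y; rewrite !inE; case: (y \in V); rewrite ?andbF.
have := dG x; rewrite !dE.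
suff -> : deg_in G' (~: V) x = deg_in G (~: V) x by move/addIn.
apply: eq_card => y; rewrite !inE; case: (boolP (y \in V)) => //= yV.
by rewrite adj_sym eG // adj_sym.
Qed.

Definition same_pair a b x y := (x == a) && (y == b) || (x == b) && (y == a).

Lemma same_pairC a b x y : same_pair a b x y = same_pair a b y x.
Proof. by rewrite /same_pair orbC andbC [X in _ || X]andbC. Qed.

Definition swap_rel G a b c d : rel T := fun x y =>
  [&& G x y, ~~ same_pair a b x y & ~~ same_pair c d x y]
  || (same_pair a c x y || same_pair b d x y).

(* a, b, c, d are automatically distinct: a = d or b = c would make the edge
   cd or ab equal to the non-edge ac. *)
Lemma swap_sim V G a b c d :
    a \in V -> b \in V -> c \in V -> d \in V ->
    G a b -> G c d -> ~~ G a c -> ~~ G b d -> a != c -> b != d ->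
  exists2 G', sim V G' G & forall x y, G' x y = swap_rel G a b c d x y.
Proof.
move=> aV bV cV dV ab cd ac bd nac nbd.
have symG := adj_sym G.
have neq x y : G x y -> x != y by apply: contraTneq => ->; rewrite adj_irr.
have ba : G b a by rewrite symG.
have dc : G d c by rewrite symG.
have ca : ~~ G c a by rewrite symG.
have db : ~~ G d b by rewrite symG.
have nab := neq _ _ ab; have ncd := neq _ _ cd.
have nad : a != d by apply: contraNneq ac => ->; rewrite symG.
have nbc : b != c by apply: contraNneq ac => <-.
have sw_sym : symmetric (swap_rel G a b c d).
  by move=> x y; rewrite /swap_rel symG !(same_pairC _ _ x).
have sw_irr : irreflexive (swap_rel G a b c d).
  move=> x; rewrite /swap_rel adj_irr /= /same_pair; apply/negP.
  by case/orP; case/orP; case/andP=> /eqP-> /eqP e; move: nac nbd; rewrite e eqxx.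
exists (SGraph sw_sym sw_irr) => //; split=> [x|x y xV] /=; last first.
  have n z : z \in V -> (x == z) = false by apply: contraTF => /eqP<-.
  by rewrite /swap_rel /same_pair !n //= !andbT orbF.
have move_card (A : {set T}) s t : s \in A -> t \notin A -> #|t |: (A :\ s)| = #|A|.
  move=> sA tA; rewrite cardsU1 !inE (negbTE tA) andbF /=.
  by rewrite [in RHS](cardsD1 s) sA.
(* Each of the four switched vertices trades one neighbour [s] for a new one [t]; all other vertices
   keep their neighbourhoods. *)
have mv s t : G x s -> ~~ G x t ->
    [set y | swap_rel G a b c d x y] = t |: ([set y | G x y] :\ s) ->
    #|[set y | swap_rel G a b c d x y]| = #|[set y | G x y]|.
  by move=> xs xt ->; rewrite move_card ?inE.
rewrite /degree /=.
case: (x =P a) => [xa|/eqP xa].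
  apply: (mv b c); rewrite ?xa //; apply/setP=> y.
  rewrite !inE /swap_rel /same_pair eqxx (negbTE nab) (negbTE nac) (negbTE nad) /=.
  by case: (G _ y); do ?[case: (y == _) => //=].
case: (x =P b) => [xb|/eqP xb].
  apply: (mv a d); rewrite ?xb //; apply/setP=> y.
  rewrite !inE /swap_rel /same_pair eqxx (eq_sym b a) (negbTE nab) (negbTE nbc) (negbTE nbd) /=.
  by case: (G _ y); do ?[case: (y == _) => //=].
case: (x =P c) => [xc|/eqP xc].
  apply: (mv d a); rewrite ?xc //; apply/setP=> y.
  rewrite !inE /swap_rel /same_pair eqxx ![c == _]eq_sym (negbTE nac) (negbTE nbc) (eq_sym d) (negbTE ncd) /=.
  by case: (G _ y); do ?[case: (y == _) => //=].
case: (x =P d) => [xd|/eqP xd].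
  apply: (mv c b); rewrite ?xd //; apply/setP=> y.
  rewrite !inE /swap_rel /same_pair eqxx ![d == _]eq_sym (negbTE nad) (negbTE nbd) (negbTE ncd) /=.
  by case: (G _ y); do ?[case: (y == _) => //=].
apply: eq_card => y; rewrite !inE /swap_rel /same_pair.
by rewrite (negbTE xa) (negbTE xb) (negbTE xc) (negbTE xd) /= !andbT orbF.
Qed.

(** * Lengthening a cycle by one *)

Definition cycle_in r V G p :=
  [/\ uniq p, cycle G p, size p = r & {subset p <= V}].

Definition pot_cycle r V G :=
  exists G' p, sim V G' G /\ cycle_in r V G' p.

Lemma pot_cycle_sim r V G' G : sim V G' G -> pot_cycle r V G' -> pot_cycle r V G.
Proof. by move=> s [G1 [p [s1 c]]]; exists G1, p; split=> //; apply: sim_trans s. Qed.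

Lemma pot_cycle_sub r V (W : {set T}) G :
  W \subset V -> pot_cycle r W G -> pot_cycle r V G.
Proof.
move=> WV [G1 [p [s [U c sz pW]]]]; exists G1, p; split; first exact: sim_sub s.
by split=> // x /pW; apply: (subsetP WV).
Qed.

Lemma cycle_in_rot r V G p n : cycle_in r V G p -> cycle_in r V G (rot n p).
Proof.
case=> U c sz pV; split; rewrite ?rot_uniq ?rot_cycle ?size_rot //.
by move=> x; rewrite mem_rot; apply: pV.
Qed.

Lemma rot_to_next r V G p x : cycle_in r V G p -> 1 < r -> x \in p ->
  exists q, [/\ cycle_in r V G (x :: next p x :: q), p =i x :: next p x :: q
               & next p =1 next (x :: next p x :: q)].
Proof.
move=> cp r2 xp; have [U _ sz _] := cp; have [i [|y q] ip] := rot_to xp.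
  by have := size_rot i p; rewrite ip sz => r1; rewrite -r1 in r2.
have yE : next p x = y by rewrite -(next_rot i U) ip /= eqxx.
exists q; rewrite yE -ip; split; first exact: cycle_in_rot.
  by move=> z; rewrite mem_rot.
by move=> z; rewrite next_rot.
Qed.

Lemma insert_between r V G x y q u : cycle_in r V G (x :: y :: q) ->
  u \in V -> u \notin x :: y :: q -> G u x -> G u y -> pot_cycle r.+1 V G.
Proof.
move=> [U c sz pV] uV up ux uy; exists G, [:: x, u, y & q]; split=> //.
have pE : perm_eq [:: x, u, y & q] [:: u, x, y & q] by rewrite (perm_catCA [:: x] [:: u]).
split.
- by rewrite (perm_uniq pE) /= up.
- by move: c => /= /andP[xy ->]; rewrite adj_sym ux uy.
- by move: sz => /= <-.
- by move=> z; rewrite (perm_mem pE) inE => /orP[/eqP->//|]; apply: pV.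
Qed.

Lemma insert_next r V G p x u : cycle_in r V G p -> 1 < r -> x \in p ->
  u \in V -> u \notin p -> G u x -> G u (next p x) -> pot_cycle r.+1 V G.
Proof.
move=> cp r2 xp uV up ux uy; have [q [cq pq _]] := rot_to_next cp r2 xp.
by apply: insert_between cq uV _ ux uy; rewrite -pq.
Qed.

(* If u is not already adjacent to the successor y of x, switch xy, uz -> uy, xz
   and replace the edge xy of the cycle by the path x u y. *)
Lemma insert_swap r V G p x u z : cycle_in r V G p -> 2 < r -> x \in p ->
    u \in V -> u \notin p -> z \in V -> G u x -> G u z -> z != x -> ~~ G x z ->
  pot_cycle r.+1 V G.
Proof.
move=> cp r3 xp uV up zV ux uz zx xz; have r2 := ltnW r3.
case: (boolP (G u (next p x))) => [|uny]; first exact: insert_next ux.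
have [q [cq pq _]] := rot_to_next cp r2 xp; rewrite pq in up.
move: (next p x) uny cq up {pq} => y uny cq; have [U c sz pV] := cq.
rewrite !inE !negb_or => /and3P[ux' uy' uq].
have xy : G x y by case/andP: c.
have [||||//|//||//||//|G' s G'E] := @swap_sim V G y x u z.
- by apply: pV; rewrite !inE eqxx orbT.
- by apply: pV; rewrite mem_head.
- exact: uV.
- exact: zV.
- by rewrite adj_sym.
- by rewrite adj_sym.
- by rewrite eq_sym.
- by rewrite eq_sym.
apply: (pot_cycle_sim s); move: U => /= /and3P[]; rewrite inE negb_or => /andP[nxy xq] yq Uq.
(* Every switched pair meets [u] or [y], so edges avoiding both survive; the edge from [y] to its
   successor [t] is checked separately. *)
have G'_off v w : v \notin [:: u; y] -> w \notin [:: u; y] -> G v w -> G' v w.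
  rewrite !inE !negb_or => /andP[vu vy] /andP[wu wy] vw.
  by rewrite G'E /swap_rel vw /same_pair !(negbTE vu, negbTE vy, negbTE wu, negbTE wy) /= !andbF.
have G'ux : G' u x.
  rewrite G'E /swap_rel ux /same_pair (negbTE uy') (negbTE ux') (eq_sym x z) (negbTE zx) /= !andbF /=.
  by rewrite (_ : (u == z) = false) //; apply: contraTF uz => /eqP->; rewrite adj_irr.
have G'uy : G' u y by rewrite G'E /swap_rel /same_pair !eqxx /= !orbT.
exists G', [:: x, u, y & q]; split; first exact: sim_refl.
case: q sz c {cq} pV xq yq uq Uq => [|t q] sz c pV xq yq uq Uq.
  by move: sz r3 => /= <-.
have pE : perm_eq [:: x, u, y, t & q] [:: u, x, y, t & q] by rewrite (perm_catCA [:: x] [:: u]).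
split.
- rewrite (perm_uniq pE) cons_uniq; apply/andP; split.
    by rewrite !inE !negb_or ux' uy' -negb_or -in_cons uq.
  by rewrite cons_uniq [uniq (y :: _)]cons_uniq inE negb_or nxy xq yq Uq.
- move: c; rewrite /= [G' x u]adj_sym G'ux G'uy /= => /and3P[_ yt ct]; apply/andP; split.
    rewrite G'E /swap_rel yt /same_pair eqxx (eq_sym y) (negbTE nxy) (eq_sym y) (negbTE uy') /=.
    have [tx tu] : t != x /\ t != u.
      by split; [move: xq | move: uq]; apply: contraNneq => ->; rewrite mem_head.
    by rewrite (negbTE tx) (negbTE tu) !andbF.
  apply: (sub_in_path (P := [pred v | v \notin [:: u; y]]) G'_off _ ct).
  rewrite -rcons_cons all_rcons; apply/andP; split.
    by rewrite !inE negb_or eq_sym ux' nxy.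
  apply/allP=> v vq; rewrite !inE negb_or.
  by apply/andP; split; [move: uq | move: yq]; apply: contraNneq => <-.
- by move: sz => /= <-.
- by move=> v; rewrite (perm_mem pE) inE => /orP[/eqP->//|]; apply: pV.
Qed.

(** A rotation along the chord [ab]: from [u] go to the predecessor of [b], run backwards to [a],
    cross to [b], run forwards to the predecessor of [a], and return to [u]. *)
Lemma insert_rotate r V G p a b u : cycle_in r V G p -> a \in p -> b \in p ->
    a != b -> u \in V -> u \notin p -> G u (prev p a) -> G u (prev p b) ->
    G a b -> pot_cycle r.+1 V G.
Proof.
move=> [U c sz pV] ap bp nab uV up ua ub ab.
have [i p1 p2 _ _ ip] := rot_to_arc U ap bp nab.
have U' := U; rewrite -(rot_uniq i) ip /= mem_cat inE !negb_or in U'.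
case/andP: U' => /and3P[ap1 _ ap2] Up12.
move: Up12; rewrite cat_uniq /= => /and3P[Up1 bp1 /andP[bp2 Up2]].
move: bp1; rewrite negb_or => /andP[bp1 _].
(* The head [a] of the rotated list does not recur in the tail, so [index] returns the length of the
   tail and [prev] reads off the last entry. *)
have pa : prev p a = last b p2.
  rewrite -(prev_rot i U) prev_nth ip mem_head memNindex; last first.
    by rewrite mem_cat inE !negb_or ap1 nab.
  by rewrite -[size _]/((size (a :: p1 ++ b :: p2)).-1) nth_last /= last_cat.
have pb : prev p b = last a p1.
  rewrite -(prev_rot i U) prev_nth ip inE mem_cat mem_head !orbT.
  rewrite index_cat (negbTE bp1) /= eqxx addn0.
  by rewrite -cat_cons nth_cat /= ltnSn -[size p1]/((size (a :: p1)).-1) nth_last.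
have pE : perm_eq (u :: rev (a :: p1) ++ b :: p2) (u :: p).
  rewrite perm_cons perm_sym -(perm_rot i p) ip -cat_cons perm_cat2r.
  by rewrite perm_sym perm_rev.
exists G, (u :: rev (a :: p1) ++ b :: p2); split=> //; split.
- by rewrite (perm_uniq pE) /= up.
- have := c; rewrite -(rot_cycle i) ip /= rcons_cat cat_path rcons_cons /=.
  case/and3P=> pa1 _ pb2.
  have -> : path G u (rcons (rev (a :: p1) ++ b :: p2) u) =
      [&& path G u (rev (a :: p1)), G a b, path G b p2 & G (last b p2) u].
    by rewrite rcons_path last_cat cat_path rev_cons last_rcons /= -!andbA.
  rewrite ab -pa [G (prev p a) u]adj_sym ua andbT /=; apply/andP; split; last first.
    by move: pb2; rewrite rcons_path => /andP[].
  rewrite lastI rev_rcons /= rev_path -pb ub /=.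
  by rewrite (eq_path (e' := G)) // => v w; rewrite adj_sym.
- by rewrite (perm_size pE) /= sz.
- by move=> v; rewrite (perm_mem pE) inE => /orP[/eqP->//|]; apply: pV.
Qed.

(** The outside edge [uw] replaces the single vertex between [x] and its second successor, a net
    gain of one. *)
Lemma insert_edge r V G p x u w : cycle_in r V G p -> 2 < r -> x \in p ->
    u \in V -> u \notin p -> w \in V -> w \notin p -> G u w ->
    G u x -> G w (next p (next p x)) -> pot_cycle r.+1 V G.
Proof.
move=> cp r3 xp uV up wV wp uw ux wt.
have [q [cq pq nq]] := rot_to_next cp (ltnW r3) xp.
move: (next p x) nq cq pq wt => y nq [U c sz pV] pq; rewrite nq.
case: q sz U c pV pq {nq} => [|t q] sz U c pV pq; first by move: sz r3 => /= <-.
have -> : next [:: x, y, t & q] y = t.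
  by move: U; rewrite /= inE eq_sym => /andP[]; case: eqP => //; rewrite eqxx.
move=> wt; move: U; rewrite (cons_uniq x) (cons_uniq y) => /and3P[xq yq Uq].
have pE : perm_eq [:: x, u, w, t & q] [:: u, w, x, t & q].
  by rewrite (perm_catCA [:: x] [:: u; w]).
exists G, [:: x, u, w, t & q]; split=> //; split.
- rewrite (perm_uniq pE) 3!cons_uniq Uq andbT.
  have nuw : u != w by apply: contraTneq uw => ->; rewrite adj_irr.
  move: up wp xq; rewrite !pq ![_ \in _ :: _]inE !negb_or nuw.
  by case/and4P=> -> _ -> -> /and4P[-> _ -> ->] /and3P[_ -> ->].
- by move: c => /= /and3P[_ _ ->]; rewrite [G x u]adj_sym ux uw wt.
- by move: sz => /= <-.
- move=> v; rewrite (perm_mem pE) 2!inE => /or3P[/eqP->//|/eqP->//|vq].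
  by apply: pV; move: vq; rewrite !inE; case/orP=> ->; rewrite ?orbT.
Qed.

(** * Chords and neighbourhoods of a cycle that cannot be lengthened *)

Definition dominates_chords V G p := forall u w x y,
  u \in V -> u \notin p -> w \in V -> w \notin p -> G u w ->
  x \in p -> y \in p -> G x y -> y != next p x -> x != next p y ->
  G u x || G w y.

(* Minimize the number of edges outside p: a chord xy violating the conclusion
   for the edge uw could be switched, uw, xy -> ux, wy. *)
Lemma exists_dominates_chords r V G p : cycle_in r V G p ->
  exists2 G', sim V G' G & cycle_in r V G' p /\ dominates_chords V G' p.
Proof.
pose out H := [set e : T * T | [&& e.1 \in V, e.1 \notin p, e.2 \in V, e.2 \notin p & H e.1 e.2]].
have [k] := ubnP #|out G|; elim: k G => // k IH G ltk cp; apply: NNPP => no.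
apply: (no); exists G => //; split=> // u w x y uV up wV wp uw xp yp xy yx xy'.
have [U c sz pV] := cp.
case: (boolP (G u x)) => //= ux; case: (boolP (G w y)) => // wy; exfalso.
have ne a b : a \notin p -> b \in p -> (a == b) = false.
  by move=> ap bp; apply: contraNF ap => /eqP->.
have ne' a b : a \notin p -> b \in p -> (b == a) = false by move=> *; rewrite eq_sym ne.
have [G' s G'E] := swap_sim uV wV (pV _ xp) (pV _ yp) uw xy ux wy
  (negbT (ne _ _ up xp)) (negbT (ne _ _ wp yp)).
case: (IH G') => [||G2 s2 [c2 d2]]; last by case: no; exists G2 => //; apply: sim_trans s.
- apply: leq_trans (ltk : _ <= k); apply: proper_card; apply/properP; split.
    apply/subsetP=> -[a b]; rewrite !inE /= => /and5P[-> ap -> bp].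
    rewrite ap bp G'E /swap_rel /same_pair !(ne _ x, ne _ y) //= !andbF /= orbF.
    by case/and3P.
  exists (u, w); first by rewrite inE /= uV up wV wp uw.
  by rewrite inE /= G'E /swap_rel /same_pair !eqxx !(ne _ x, ne _ y) //= !andbF.
(* The removed pairs are [uw], which lies off the cycle, and the chord [xy], so all edges of the
   cycle survive. *)
- split=> //; apply: cycle_from_next => // v vp.
  rewrite G'E /swap_rel /same_pair (next_cycle c vp) !(ne' u, ne' w) ?mem_next //=.
  apply/orP; left; rewrite negb_or !negb_and -!implybE.
  by apply/andP; split; apply/implyP=> /eqP->; rewrite eq_sym.
Qed.

Definition nbrs G (p : seq T) u := [set x in p | G u x].

Section Stuck.
Variables (r : nat) (V : {set T}) (G : sgraph T) (p : seq T).
Hypotheses (r3 : 2 < r) (cp : cycle_in r V G p) (stuck : ~ pot_cycle r.+1 V G).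

Let Up : uniq p. Proof. by case: cp. Qed.
Let pV x : x \in p -> x \in V. Proof. by case: cp => _ _ _; apply. Qed.
Let cyc : cycle G p. Proof. by case: cp. Qed.

Lemma next_inj : injective (next p).
Proof. exact: can_inj (prev_next Up). Qed.

Lemma stuck_dominates u x z : u \in V -> u \notin p -> x \in p -> G u x ->
  z \in V -> G u z -> z != x -> G x z.
Proof.
move=> uV up xp ux zV uz zx; apply/negPn/negP=> xz.
by apply: stuck; apply: (insert_swap cp r3 xp uV up zV ux uz).
Qed.

Lemma stuck_next u x : u \in V -> u \notin p -> x \in nbrs G p u ->
  next p x \notin nbrs G p u.
Proof.
move=> uV up; rewrite !inE mem_next => /andP[xp ux]; rewrite xp /=.
by apply/negP=> un; apply: stuck; apply: (insert_next cp (ltnW r3) xp uV up).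
Qed.

Lemma stuck_next2 u w x : u \in V -> u \notin p -> w \in V -> w \notin p ->
  G u w -> x \in nbrs G p u -> next p (next p x) \notin nbrs G p w.
Proof.
move=> uV up wV wp uw; rewrite !inE !mem_next => /andP[xp ux]; rewrite xp /=.
by apply/negP=> wn; apply: stuck; apply: (insert_edge cp r3 xp uV up wV wp uw).
Qed.

Lemma stuck_next_indep u x y : u \in V -> u \notin p ->
  x \in nbrs G p u -> y \in nbrs G p u -> ~~ G (next p x) (next p y).
Proof.
move=> uV up; rewrite !inE => /andP[xp ux] /andP[yp uy]; apply/negP=> xy.
apply: stuck; apply: (insert_rotate (a := next p x) (b := next p y) (u := u) cp) => //.
- by rewrite mem_next.
- by rewrite mem_next.
- by apply: contraTneq xy => ->; rewrite adj_irr.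
- by rewrite prev_next.
- by rewrite prev_next.
Qed.

(** A neighbour of [u] on [p] is adjacent to every other neighbour of [u], in particular to [w]. *)
Lemma nbrs_edge u w : u \in V -> u \notin p -> w \in V -> w \notin p ->
  G u w -> nbrs G p u \subset nbrs G p w.
Proof.
move=> uV up wV wp uw; apply/subsetP=> x; rewrite !inE => /andP[xp ux].
rewrite xp adj_sym (stuck_dominates uV up xp ux wV uw) //.
by apply: contraNneq wp => ->.
Qed.

Lemma card_cycle : #|[set x in p]| = r.
Proof. by rewrite cardsE (card_uniqP Up); case: cp. Qed.

(** The neighbours of [u] on [p] and their successors are disjoint sets of equal size. *)
Lemma card_nbrs2 u : u \in V -> u \notin p -> 2 * #|nbrs G p u| <= r.
Proof.
move=> uV up; rewrite -card_cycle mulSn mul1n -{2}(card_imset _ next_inj).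
rewrite -cardsUI [X in _ + X](_ : _ = 0) ?addn0.
  apply/subset_leq_card/subsetP=> x; rewrite !inE => /orP[/andP[]//|/imsetP[y]].
  by rewrite inE => /andP[yp _] ->; rewrite mem_next.
apply/eqP; rewrite cards_eq0 -subset0; apply/subsetP=> x; rewrite in_setI.
by case/andP=> xI /imsetP[y yI xy]; move: xI; rewrite xy (negbTE (stuck_next _ _ yI)).
Qed.
End Stuck.

(* Otherwise switch uw, u'w' -> uu', ww', making u and u' adjacent. *)
Lemma nbrs_out_sub r V G p u w u' w' : 2 < r -> cycle_in r V G p ->
    ~ pot_cycle r.+1 V G ->
    u \in V -> u \notin p -> w \in V -> w \notin p -> G u w ->
    u' \in V -> u' \notin p -> w' \in V -> w' \notin p -> G u' w' ->
  nbrs G p u \subset nbrs G p u'.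
Proof.
move=> r3 cp stuck uV up wV wp uw uV' up' wV' wp' uw'.
have [U c sz pV] := cp.
have sub := nbrs_edge r3 cp stuck.
have wu : G w u by rewrite adj_sym.
have wu' : G w' u' by rewrite adj_sym.
have [->//|nuu] := eqVneq u u'.
have [eww|nww] := eqVneq w w'.
  by rewrite -eww in wu'; apply: subset_trans (sub _ _ wV wp uV' up' wu'); apply: sub.
case: (boolP (G u u')) => uu; first exact: sub.
case: (boolP (G w w')) => ww.
  apply: subset_trans (sub _ _ wV' wp' uV' up' wu').
  by apply: subset_trans (sub _ _ wV wp wV' wp' ww); apply: sub.
have [G' s G'E] := swap_sim uV wV uV' wV' uw uw' uu ww nuu nww.
have ne a b : a \notin p -> b \in p -> (b == a) = false.
  by move=> ap bp; apply: contraNF ap => /eqP<-.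
(* The switch alters no pair meeting [p], so neighbourhoods on [p] agree in [G'] and [G], and the
   inclusion found in [G'] transfers back. *)
have G'p x y : x \in p -> G' x y = G x y.
  by move=> xp; rewrite G'E /swap_rel /same_pair !(ne _ x) //= andbT orbF.
have cp' : cycle_in r V G' p.
  by split=> //; apply: cycle_from_next => // x xp; rewrite G'p // next_cycle.
have stuck' : ~ pot_cycle r.+1 V G' by move/(pot_cycle_sim s).
have uu' : G' u u' by rewrite G'E /swap_rel /same_pair !eqxx orbT.
have := nbrs_edge r3 cp' stuck' uV up uV' up' uu'.
move/subsetP=> sub'; apply/subsetP=> x; have := sub' x.
by rewrite !inE; case: (boolP (x \in p)) => //= xp; rewrite !(adj_sym _ _ x) !G'p.
Qed.

(** * Structure forced by an edge outside the cycle *)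

Section OutEdge.
Variables (r : nat) (V : {set T}) (G : sgraph T) (p : seq T) (u w : T).
Hypotheses (r3 : 2 < r) (cp : cycle_in r V G p) (stuck : ~ pot_cycle r.+1 V G).
Hypotheses (dom : dominates_chords V G p).
Hypotheses (uV : u \in V) (up : u \notin p) (wV : w \in V) (wp : w \notin p).
Hypothesis uw : G u w.

Let Up : uniq p. Proof. by case: cp. Qed.
Let I := nbrs G p u.
Let J := next p @: I.
Let K := next p @: J.

Lemma nbrs_out_eq u' w' : u' \in V -> u' \notin p -> w' \in V -> w' \notin p ->
  G u' w' -> nbrs G p u' = I.
Proof.
move=> uV' up' wV' wp' uw'; apply/eqP; rewrite eqEsubset.
apply/andP; split; first exact: (nbrs_out_sub r3 cp stuck) uw' _ _ _ _ uw.
exact: (nbrs_out_sub r3 cp stuck) uw _ _ _ _ uw'.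
Qed.

Let disj : [disjoint I & J] /\ [disjoint I & K].
Proof.
have Iw : nbrs G p w = I by apply: (@nbrs_out_eq _ u) => //; rewrite adj_sym.
split; rewrite disjoint_sym; apply/pred0P=> x /=; apply/negbTE/negP.
  by case/andP=> /imsetP[y yI ->]; rewrite (negbTE (stuck_next r3 cp stuck uV up yI)).
case/andP=> /imsetP[_ /imsetP[y yI ->] ->]; rewrite -Iw.
by rewrite (negbTE (stuck_next2 r3 cp stuck uV up wV wp uw yI)).
Qed.

(** [I] and its shifts by one and by two steps along [p] are pairwise disjoint. *)
Lemma card_nbrs3 : 3 * #|I| <= r.
Proof.
have [IJ IK] := disj; have inj := next_inj cp.
have JK : [disjoint J & K].
  apply/pred0P=> x /=; apply/negbTE/negP => /andP[/imsetP[y yI ->]].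
  by rewrite (mem_imset _ _ inj) => yJ; move/pred0P/(_ y): IJ; rewrite /= yI yJ.
have cJ : #|J| = #|I| by rewrite card_imset.
have cK : #|K| = #|I| by rewrite card_imset.
rewrite -(card_cycle cp).
have -> : 3 * #|I| = #|I :|: (J :|: K)|.
  rewrite !cardsU !(disjoint_setI0 JK) setIUr !(disjoint_setI0 IJ, disjoint_setI0 IK).
  by rewrite setU0 cards0 !subn0 cJ cK; clear; lia.
apply/subset_leq_card/subsetP=> x; rewrite !inE => /or3P[/andP[]//|/imsetP[y]|/imsetP[z]].
  by rewrite inE => /andP[yp _] ->; rewrite mem_next.
by case/imsetP=> y; rewrite inE => /andP[yp _] -> ->; rewrite !mem_next.
Qed.

(** As [y] is not adjacent to [w], every chord at [y] ends in [I]; only the two cycle neighbours of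
    [y] can add to [I]. The two boolean terms record when the predecessor or the successor lies in
    [I] and so adds nothing. *)
Lemma deg_cycle y : y \in p -> y \notin I ->
  deg_in G [set x in p] y + (y \in J) + (next p y \in I) <= #|I| + 2.
Proof.
move=> yp yI; have wu : G w u by rewrite adj_sym.
have Iw : nbrs G p w = I by apply: (@nbrs_out_eq _ u).
set a := prev p y; have -> : (y \in J) = (a \in I).
  by rewrite -[y in LHS](next_prev Up) (mem_imset _ _ (next_inj cp)).
set b := next p y.
have sub : [set z in [set x in p] | G y z] \subset
    I :|: ([set z in [set a] | z \notin I] :|: [set z in [set b] | z \notin I]).
  apply/subsetP=> z; rewrite 2!inE => /andP[zp yz]; rewrite !inE zp -/I.
  case: (boolP (G u z)) => //= uz.
  case: (z =P a) => //= /eqP za; case: (z =P b) => //= /eqP zb.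
  have := @dom u w z y uV up wV wp uw zp yp; rewrite adj_sym yz (negbTE uz).
  rewrite (_ : y != next p z) ?zb //; last by apply: contra za => /eqP yE; rewrite /a yE prev_next.
  move=> /(_ isT isT isT) /= wy; move: yI; rewrite -Iw inE yp /=.
  by rewrite wy.
have cs c : #|[set z in [set c] | z \notin I]| + (c \in I) <= 1.
  case: (boolP (c \in I)) => cI.
    rewrite (_ : [set z in _ | _] = set0) ?cards0 //.
    by apply/setP=> z; rewrite !inE; case: eqP => // ->; move: cI; rewrite inE => ->.
  rewrite addn0 -(cards1 c); apply/subset_leq_card/subsetP=> z.
  by rewrite inE => /andP[].
have := leq_trans (subset_leq_card sub) (leq_trans (leq_card_setU _ _).1
  (leq_add (leqnn _) (leq_card_setU _ _).1)).
rewrite -/(deg_in _ _ _); move: (cs a) (cs b); rewrite -/b.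
by move: (a \in I) (b \in I) => b1 b2; clear; lia.
Qed.
End OutEdge.

(** * Degree sums and the two lengthening steps *)

Lemma deg_in_setD G V (A : {set T}) x : A \subset V ->
  deg_in G V x = deg_in G A x + deg_in G (V :\: A) x.
Proof.
move=> AV; rewrite /deg_in -(cardsID A [set y in V | G x y]); congr (_ + _).
  apply: eq_card => y; rewrite !inE; case: (boolP (y \in A)) => [/(subsetP AV)->|]; rewrite ?andbT ?andbF //.
by apply: eq_card => y; rewrite !inE andbA.
Qed.

Lemma deg_in_nbrs G (p : seq T) u : deg_in G [set x in p] u = #|nbrs G p u|.
Proof. by apply: eq_card => x; rewrite !inE. Qed.

Lemma deg_in_gt0 G V x : 0 < deg_in G V x -> exists2 y, y \in V & G x y.
Proof. by case/card_gt0P=> y; rewrite inE => /andP[]; exists y. Qed.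

Lemma cycle_in_sub r V G p : cycle_in r V G p -> [set x in p] \subset V.
Proof. by case=> _ _ _ pV; apply/subsetP=> x; rewrite inE => /pV. Qed.

(** At most [m] neighbours of an outside vertex lie on [p], so each has an outside neighbour and all
    share the set [I]. A cycle vertex not in [I] then has all its neighbours on [p]; applied to the
    successor of an element of [I], [deg_cycle] gives [m <= #|I|], against
    [3 * #|I| <= 2 * m + 1]. *)
Lemma step_min_degree m r V G : 1 < m -> 2 < r <= 2 * m + 1 -> r < #|V| ->
  (forall x, x \in V -> m < deg_in G V x) -> pot_cycle r V G -> pot_cycle r.+1 V G.
Proof.
move=> m2 /andP[r3 rm] rV dG [G1 [p [s1 c1]]].
have [G2 s2 [cp dom]] := exists_dominates_chords c1.
have s := sim_trans s2 s1; apply: (pot_cycle_sim s); apply: NNPP => stuck.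
have {}dG x : x \in V -> m < deg_in G2 V x by move/dG; rewrite (sim_deg_in x s).
move: G2 cp dom stuck dG {G G1 s s1 s2 c1} => G cp dom stuck dG.
have CV := cycle_in_sub cp.
have out_edge u : u \in V -> u \notin p -> exists2 w, (w \in V) && (w \notin p) & G u w.
  move=> uV up; have := dG u uV; rewrite (deg_in_setD _ _ CV) deg_in_nbrs.
  have := card_nbrs2 r3 cp stuck uV up => I2.
  set D := deg_in G _ u => d; have /deg_in_gt0[w] : 0 < D by lia.
  by rewrite !inE andbC; exists w.
have [u uO] : exists u, u \in V :\: [set x in p].
  by apply/card_gt0P; rewrite cardsD (setIidPr CV) (card_cycle cp) subn_gt0.
move: uO; rewrite !inE => /andP[up uV]; have [w /andP[wV wp] uw] := out_edge u uV up.
have Ieq := nbrs_out_eq r3 cp stuck uV up wV wp uw.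
have I3 := card_nbrs3 r3 cp stuck uV up wV wp uw.
set I := nbrs G p u in Ieq I3.
have deg_y y : y \in p -> y \notin I -> m + (y \in next p @: I) <= #|I| + 1.
  move=> yp yI; have := deg_cycle r3 cp stuck dom uV up wV wp uw yp yI; rewrite -/I.
  have yV : y \in V by case: cp => _ _ _; apply.
  suff out0 : deg_in G (V :\: [set x in p]) y = 0.
    by have := dG y yV; rewrite (deg_in_setD _ _ CV) out0; clear; lia.
  apply/eqP; rewrite -leqn0 leqNgt; apply/negP=> /deg_in_gt0[z].
  rewrite !inE => /andP[zp zV] yz; have [z' /andP[zV' zp'] zz'] := out_edge z zV zp.
  by move: yI; rewrite -(Ieq z z') // inE yp adj_sym yz.
have [I0|[x xI]] := set_0Vmem I.
  have [y] : exists y, y \in [set x in p] by apply/card_gt0P; rewrite (card_cycle cp); lia.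
  by rewrite inE => /deg_y; rewrite I0 inE cards0; move: m2; clear; lia.
have := deg_y (next p x); rewrite mem_next (mem_imset _ _ (next_inj cp)) xI.
rewrite (stuck_next r3 cp stuck uV up xI) => /(_ _ isT) H.
have xp : x \in p by move: xI; rewrite inE => /andP[].
by have := H xp; move: I3 m2 rm; clear; lia.
Qed.

Definition deg_sum_in G V := \sum_(x in V) deg_in G V x.

Lemma deg_inE G V x : deg_in G V x = \sum_(y in V) G x y.
Proof.
rewrite /deg_in -sum1_card [LHS]big_mkcond [RHS]big_mkcond /=.
by apply: eq_bigr => y _; rewrite inE; case: (y \in V); case: (G x y).
Qed.

Lemma edge_count G (A B : {set T}) :
  \sum_(x in A) deg_in G B x = \sum_(x in B) deg_in G A x.
Proof.
under eq_bigr do rewrite deg_inE.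
rewrite exchange_big; apply: eq_bigr => x _; rewrite deg_inE.
by apply: eq_bigr => y _; rewrite adj_sym.
Qed.

Lemma deg_in_lt G V x : x \in V -> deg_in G V x < #|V|.
Proof.
move=> xV; apply/proper_card/properP; split.
  by apply/subsetP=> y; rewrite inE => /andP[].
by exists x => //; rewrite inE adj_irr andbF.
Qed.

Lemma sum_leq_card (A : {set T}) (F : T -> nat) k :
  (forall x, x \in A -> F x <= k) -> \sum_(x in A) F x <= #|A| * k.
Proof. by move=> Fk; rewrite -sum_nat_const; apply: leq_sum. Qed.

Lemma sum_card_in (A : {set T}) (P : pred T) :
  \sum_(x in A) P x = #|[set x in A | P x]|.
Proof.
rewrite -sum1_card [LHS]big_mkcond [RHS]big_mkcond /=.
by apply: eq_bigr => y _; rewrite inE; case: (y \in A); case: (P y).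
Qed.

(** Edges between [C] and its complement are counted from both ends; charging both to the outside
    vertex gives the factor 2. *)
Lemma deg_sum_split G V (C : {set T}) : C \subset V ->
  deg_sum_in G V = \sum_(x in C) deg_in G C x
    + \sum_(u in V :\: C) (2 * deg_in G C u + deg_in G (V :\: C) u).
Proof.
move=> CV; rewrite /deg_sum_in (big_setID C) /= (setIidPr CV).
rewrite (eq_bigr _ (fun x _ => deg_in_setD G x CV)).
rewrite [X in _ + X](eq_bigr _ (fun x _ => deg_in_setD G x CV)) !big_split /=.
by rewrite [X in _ + X + _]edge_count big1_eq; move: (\sum_(_ in _) _) (\sum_(_ in _) _) (\sum_(_ in _) _) => a b c; lia.
Qed.

Lemma step_count m e V G : 1 < m -> e <= 1 -> #|V| = 3 * m ->
  m * (5 * m - 1) + 2 * m * e < deg_sum_in G V ->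
  pot_cycle (2 * m + e) V G -> pot_cycle (2 * m + e).+1 V G.
Proof.
move=> m2 e1 cV; set r := 2 * m + e.
have r3 : 2 < r by rewrite /r; lia.
move=> big [G1 [p [s1 c1]]].
have [G2 s2 [cp dom]] := exists_dominates_chords c1.
have s := sim_trans s2 s1; apply: (pot_cycle_sim s); apply: NNPP => stuck.
have {}big : m * (5 * m - 1) + 2 * m * e < deg_sum_in G2 V.
  by rewrite /deg_sum_in (eq_bigr _ (fun x _ => sim_deg_in x s)).
move: G2 cp dom stuck big {G G1 s s1 s2 c1} => G cp dom stuck big.
have CV := cycle_in_sub cp; have [U _ _ _] := cp.
move: big; rewrite (deg_sum_split G CV); apply/negP; rewrite -leqNgt.
set C := [set x in p] in CV *; set O := V :\: C.
have cC : #|C| = r := card_cycle cp.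
have cO : #|O| = m - e by rewrite cardsD (setIidPr CV) cC cV /r; lia.
have inO u : u \in O = (u \in V) && (u \notin p) by rewrite !inE andbC.
have dI u : deg_in G C u = #|nbrs G p u| := deg_in_nbrs G p u.
have [u0 u0O] : exists u, u \in O by apply/card_gt0P; rewrite cO; lia.
have I2 u : u \in O -> 2 * #|nbrs G p u| <= r.
  by rewrite inO => /andP[]; apply: card_nbrs2.
have IC u : nbrs G p u \subset C by apply/subsetP=> x; rewrite !inE => /andP[].
have inj := next_inj cp.
case: (boolP [exists u in O, 0 < deg_in G O u]) => [|noedge].
  case/exists_inP=> u uO /deg_in_gt0[w wO uw].
  have [/andP[uV up] /andP[wV wp]] : ((u \in V) && (u \notin p)) /\ ((w \in V) && (w \notin p)).
    by rewrite -!inO.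
  have Ieq := nbrs_out_eq r3 cp stuck uV up wV wp uw.
  have I3 := card_nbrs3 r3 cp stuck uV up wV wp uw.
  have dy := deg_cycle r3 cp stuck dom uV up wV wp uw.
  set I := nbrs G p u in Ieq I3 dy; set J := next p @: I in dy.
  (* A vertex with an outside neighbour has exactly [I] on [p]; one without has at most [m]
     neighbours on [p], by parity when [e = 1]. *)
  have boundO : \sum_(u in O) (2 * deg_in G C u + deg_in G O u) <=
      (m - e) * maxn (2 * #|I| + (m - e) - 1) (2 * m).
    rewrite -cO; apply: sum_leq_card => u' uO'; rewrite dI leq_max.
    have := I2 _ uO'; have := deg_in_lt G uO'; have [->|] := posnP (deg_in G O u').
      by move=> _ I2'; apply/orP; right; clear -I2' e1; rewrite /r in I2'; lia.
    case/deg_in_gt0=> w' wO' uw'; move: (uO') (wO'); rewrite !inO.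
    case/andP=> uV' up' /andP[wV' wp']; rewrite (Ieq u' w') // => lt _.
    by apply/orP; left; clear -lt; lia.
  (* The term [2 * #|I|] collects the boolean terms of [deg_cycle]: each element of [I] has its
     successor and its predecessor outside [I]. *)
  have boundC : \sum_(x in C) deg_in G C x + 2 * #|I| <=
      #|I| * (r - 1) + (r - #|I|) * (#|I| + 2).
    have CI : #|C :\: I| = r - #|I| by rewrite cardsD (setIidPr (IC u)) cC.
    rewrite (big_setID I) /= (setIidPr (IC u)) -addnA leq_add //.
      apply: sum_leq_card => x xI; have := deg_in_lt G (subsetP (IC u) _ xI).
      by rewrite cC; clear; lia.
    rewrite -CI; apply: leq_trans (_ : \sum_(x in C :\: I)
       (deg_in G C x + (x \in J) + (next p x \in I)) <= _); last first.
      by apply: sum_leq_card => x; rewrite in_setD => /andP[xI xC]; apply: dy; rewrite // inE in xC.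
    rewrite !big_split /= !sum_card_in -addnA leq_add2l mul2n -addnn leq_add //.
      rewrite -(card_imset _ inj); apply/subset_leq_card/subsetP=> x xJ; rewrite inE xJ andbT.
      case/imsetP: xJ => y yI ->; rewrite inE (stuck_next r3 cp stuck uV up yI).
      by rewrite inE mem_next; move: yI; rewrite inE => /andP[].
    rewrite -(card_imset _ (can_inj (next_prev U))); apply/subset_leq_card/subsetP=> x.
    case/imsetP=> y yI ->; rewrite inE (next_prev U) yI andbT inE.
    rewrite (contraL (stuck_next r3 cp stuck uV up (x := prev p y))) ?next_prev //=.
    by rewrite inE mem_prev; move: yI; rewrite inE => /andP[].
  have := outside_edge_bound m2 e1 I3 (leqnn _); clear -boundO boundC; rewrite /r in boundC *; lia.
have dO u : u \in O -> deg_in G O u = 0.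
  move=> uO; apply/eqP; rewrite -leqn0 leqNgt; apply: contra noedge => d0.
  by apply/exists_inP; exists u.
have [u uO umax] := @arg_maxnP _ u0 (mem O) (fun u => #|nbrs G p u|) u0O.
set I := nbrs G p u in umax; set J := next p @: I.
have [uV up] : u \in V /\ u \notin p by apply/andP; rewrite -inO.
have JC : J \subset C.
  by apply/subsetP=> _ /imsetP[y yI ->]; rewrite inE mem_next; move: yI; rewrite inE => /andP[].
have cJ : #|J| = #|I| by rewrite card_imset.
have Im : #|I| <= m by have := I2 u uO; rewrite -/I /r; clear -e1; lia.
have boundO : \sum_(u in O) (2 * deg_in G C u + deg_in G O u) <= (m - e) * (2 * #|I|).
  rewrite -cO; apply: sum_leq_card => u' uO'; rewrite dI dO // addn0 leq_mul2l /=.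
  exact: umax.
(* The successors [J] are independent, so a vertex of [J] has at most [r - #|I|] neighbours on
   [p]. *)
have boundC : \sum_(x in C) deg_in G C x <= #|I| * (r - #|I|) + (r - #|I|) * (r - 1).
  have CJ : #|C :\: J| = r - #|I| by rewrite cardsD (setIidPr JC) cC cJ.
  rewrite (big_setID J) /= (setIidPr JC) leq_add //; last first.
    rewrite -CJ; apply: sum_leq_card => x; rewrite inE => /andP[_ xC].
    by have := deg_in_lt G xC; rewrite cC; clear; lia.
  rewrite -cJ; apply: sum_leq_card => x xJ; rewrite cJ -CJ.
  apply/subset_leq_card/subsetP=> y; rewrite !inE => /andP[yp xy]; rewrite yp andbT.
  case/imsetP: xJ xy => x' xI -> xy; apply/negP=> /imsetP[y' yI yE].
  by move: xy; rewrite yE (negbTE (stuck_next_indep cp stuck uV up xI yI)).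
have := independent_outside_bound m2 e1 Im; clear -boundO boundC; rewrite /r in boundC *; lia.
Qed.

(** * Vertex deletion, base cases and the induction *)

Lemma deg_sum_in_D1 G V v : v \in V ->
  deg_sum_in G V = deg_sum_in G (V :\ v) + 2 * deg_in G V v.
Proof.
move=> vV; have sV : V :\ v \subset V by apply: subsetDl.
rewrite (deg_sum_split G sV); congr (_ + _).
have -> : V :\: (V :\ v) = [set v] by rewrite setDDr setDv set0U (setIidPr _) ?sub1set.
rewrite big_set1 (deg_in_setD G v sV).
have -> : V :\: (V :\ v) = [set v] by rewrite setDDr setDv set0U (setIidPr _) ?sub1set.
suff -> : deg_in G [set v] v = 0 by rewrite !addn0.
by apply/eqP; rewrite -leqn0 -ltnS -(cards1 v) deg_in_lt ?inE.
Qed.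

(* Without triangles, neighbourhoods (minus u) of the neighbours a, b, c of u
   are pairwise disjoint and, by the switch ap, bs -> ab, ps, completely joined;
   one vertex from each gives a triangle. *)
Lemma pot_triangle V G : 0 < #|V| -> (forall x, x \in V -> 2 < deg_in G V x) ->
  pot_cycle 3 V G.
Proof.
case/card_gt0P=> u uV dG; apply: NNPP => stuck.
have neq G' x y : G' x y -> x != y by apply: contraTneq => ->; rewrite (adj_irr G').
have tri G' x y z : sim V G' G -> x \in V -> y \in V -> z \in V ->
    G' x y -> G' y z -> G' z x -> False.
  move=> s xV yV zV xy yz zx; apply: stuck; apply: (pot_cycle_sim s).
  exists G', [:: x; y; z]; split; first exact: sim_refl.
  split=> //=; first by rewrite !inE negb_or (neq _ _ _ xy) (neq _ _ _ yz) eq_sym (neq _ _ _ zx).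
    by rewrite xy yz zx.
  by move=> t; rewrite !inE => /or3P[] /eqP->.
have triG x y z := tri G x y z (sim_refl V G).
have other x : x \in V -> forall v v', exists y, [/\ y \in V, G x y, y != v & y != v'].
  move=> xV v v'; have := dG x xV; rewrite /deg_in => d.
  have /card_gt0P[y] : 0 < #|[set y in V | G x y] :\: [set v; v']|.
    rewrite cardsD subn_gt0; apply: leq_ltn_trans d.
    by apply: leq_trans (subset_leq_card (subsetIr _ _)) _; rewrite cards2; case: eqP.
  by rewrite !inE negb_or => /andP[/andP[yv yv'] /andP[yV xy]]; exists y.
have K a b p s : a \in V -> b \in V -> p \in V -> s \in V -> G u a -> G u b ->
    a != b -> G a p -> G b s -> p != u -> s != u -> p != s -> G p s.
  move=> aV bV pV sV ua ub nab ap bs pu su ps; apply/negPn/negP => nps.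
  have nGab : ~~ G a b.
    by apply/negP=> ab; apply: (triG u a b) => //; rewrite adj_sym.
  have [G' s' G'E] := swap_sim aV pV bV sV ap bs nGab nps nab ps.
  have ua' := neq _ _ _ ua; have ub' := neq _ _ _ ub.
  apply: (tri G' u a b) => //; rewrite G'E /swap_rel /same_pair.
  - by rewrite ua (negbTE ua') (negbTE ub') ![u == _]eq_sym (negbTE pu) (negbTE su).
  - by rewrite !eqxx orbT.
  by rewrite adj_sym ub (negbTE ua') (negbTE ub') ![u == _]eq_sym (negbTE pu) (negbTE su) !andbF.
(* If [p] were a common neighbour, [K] would join it to a second neighbour [p'] of [a], closing a
   triangle. *)
have D a b p : a \in V -> b \in V -> p \in V -> G u a -> G u b -> a != b ->
    p != u -> G a p -> ~~ G b p.
  move=> aV bV pV ua ub nab pu ap; apply/negP=> bp.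
  have [p' [pV' ap' pu' pp']] := other a aV u p.
  by apply: (triG a p' p) => //; [apply: (K a b) | rewrite adj_sym].
have [a [aV ua _ _]] := other u uV u u.
have [b [bV ub ba _]] := other u uV a a.
have [c [cV uc ca cb]] := other u uV a b.
have [p [pV ap pu _]] := other a aV u u.
have [s [sV bs su _]] := other b bV u u.
have [t [tV ct tu _]] := other c cV u u.
have ne x v w : G x v -> ~~ G x w -> v != w by move=> xv; apply: contraNneq => <-.
apply: (triG p s t) => //.
- apply: (K a b) => //; first by rewrite eq_sym.
  by rewrite eq_sym; apply: (ne b) bs _; apply: (D a) => //; rewrite eq_sym.
- apply: (K b c) => //; first by rewrite eq_sym.
  by rewrite eq_sym; apply: (ne c) ct _; apply: (D b) => //; rewrite eq_sym.
apply: (K c a) => //.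
by rewrite eq_sym; apply: (ne a) ap _; apply: (D c).
Qed.

(** Deleting a vertex of degree at most 2 lowers the threshold by at most 4; once all degrees exceed
    2, a triangle exists and can be lengthened. *)
Lemma pot_C4 V G : 4 <= #|V| -> 4 * #|V| <= deg_sum_in G V + 4 -> pot_cycle 4 V G.
Proof.
have [k] := ubnP #|V|; elim: k V => // k IH V /ltnSE cVk c4 dsV.
case: (boolP [exists v in V, deg_in G V v <= 2]) => [/exists_inP[v vV dv]|small]; last first.
  have dV x : x \in V -> 2 < deg_in G V x.
    by move=> xV; rewrite ltnNge; apply: contra small => ?; apply/exists_inP; exists x.
  have V0 : 0 < #|V| by lia.
  exact: (step_min_degree (m := 2)) (pot_triangle V0 dV).
have := deg_sum_in_D1 G vV; have := cardsD1 v V; rewrite vV => cV ds.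
have [V4|V5] := eqVneq #|V| 4; last first.
  by apply: (pot_cycle_sub (subsetDl V [set v])); apply: IH; lia.
(* On four vertices the hypothesis asks for degree sum 12, but [v] accounts for at most 4 and the
   other three vertices leave at most 6. *)
suff : deg_sum_in G (V :\ v) <= 3 * 2 by lia.
have -> : 3 = #|V :\ v| by lia.
apply: sum_leq_card => x xV; have := deg_in_lt G xV; lia.
Qed.

Lemma pot_cycle_step m e : 1 < m -> e <= 1 ->
    (forall V G, 3 * m <= #|V| ->
       2 * m * #|V| + 2 * m * e + 2 <= deg_sum_in G V + m * (m + 1) ->
     pot_cycle (2 * m + e) V G) ->
  forall V G, 3 * m <= #|V| ->
    2 * m * #|V| + 2 * m * e + 2 <= deg_sum_in G V + m * (m + 1) ->
  pot_cycle (2 * m + e).+1 V G.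
Proof.
move=> m2 e1 pot V G; have [k] := ubnP #|V|; elim: k V => // k IH V /ltnSE cVk c3 dsV.
have [cV|cV] := eqVneq #|V| (3 * m).
  apply: step_count => //; last exact: pot.
  rewrite cV in dsV; have : 5 * m = (5 * m - 1) + 1 by lia.
  move: (5 * m - 1) => q qE; have : m * (5 * m) = m * (q + 1) by rewrite qE.
  lia.
case: (boolP [exists v in V, deg_in G V v <= m]) => [/exists_inP[v vV dv]|small]; last first.
  have dV x : x \in V -> m < deg_in G V x.
    by move=> xV; rewrite ltnNge; apply: contra small => ?; apply/exists_inP; exists x.
  apply: (step_min_degree (m := m)) => //; [lia|lia|exact: pot].
have := deg_sum_in_D1 G vV; have := cardsD1 v V; rewrite vV => cV' ds.
by apply: (pot_cycle_sub (subsetDl V [set v])); apply: IH; lia.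
Qed.

(* The second hypothesis reads m(2|V| - m - 1) + 2me + 2 <= deg_sum_in G V. *)
Lemma pot_cycle_main m e V G : 1 < m -> e <= 1 -> 3 * m <= #|V| ->
    2 * m * #|V| + 2 * m * e + 2 <= deg_sum_in G V + m * (m + 1) ->
  pot_cycle (2 * m + e).+1 V G.
Proof.
move=> m2; elim: m m2 e V G => // m IH m2.
have step0 V G : 3 * m.+1 <= #|V| ->
    2 * m.+1 * #|V| + 2 * m.+1 * 0 + 2 <= deg_sum_in G V + m.+1 * (m.+1 + 1) ->
  pot_cycle (2 * m.+1 + 0).+1 V G.
  apply: pot_cycle_step => // {}V {}G cV ds.
  have [m1|m1] := leqP m 1.
    have mE : m = 1 by lia.
    subst m; by apply: pot_C4; lia.
  (* The case [e = 1] for [m] already gives length [2 * m + 2]; its threshold is no larger because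
     [2 * #|V|] is at least [4 * m + 2]. *)
  have -> : 2 * m.+1 + 0 = (2 * m + 1).+1 by lia.
  apply: IH => //; first by lia.
  nia.
move=> e V G e1 cV ds; have [e0|e0] : e = 0 \/ e = 1 by lia.
  by rewrite e0 in ds *; apply: step0.
rewrite e0 in ds *; apply: (pot_cycle_step m2) => // {cV ds}V {}G cV ds.
have -> : 2 * m.+1 + 1 = (2 * m.+1 + 0).+1 by lia.
by apply: step0 => //; lia.
Qed.

End Graphs.

(** * Transfer to degree sequences *)

Lemma cycle_in_contains (T : finType) r V (G : sgraph T) p :
  cycle_in r V G p -> contains_subgraph (cycle_graph r) G.
Proof.
case=> U c <- _; case: p U c => [|x q] U c.
  by exists (fun i : 'I_0 => False_rect T (notF (valP i))) => [[]|[]].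
set p := x :: q in U c *; exists (fun i : 'I_(size p) => nth x p i).
  by move=> i j /eqP; rewrite nth_uniq // => /eqP/val_inj.
have adj_next (i : 'I_(size p)) : G (nth x p i) (nth x p (ordS i)).
  suff <- : next p (nth x p i) = nth x p (ordS i) by apply: next_cycle; rewrite ?mem_nth.
  have -> : next p (nth x p i) = nth x q i by rewrite next_nth mem_nth // index_uniq.
  have [lt_i|ge_i] := ltnP i.+1 (size p).
    by rewrite (_ : val (ordS i) = i.+1) //=; apply: modn_small.
  (* At the last index [nth] runs off [q] and returns its default [x], the head of the cycle, which
     is where [ordS] wraps to. *)
  have iE : i = size q :> nat by apply/eqP; rewrite eqn_leq -ltnS (ltn_ord i).
  by rewrite [in LHS]iE nth_default // (_ : val (ordS i) = 0) //= iE modnn.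
move=> i j /andP[_ /orP[/eqP->|/eqP->]]; first exact: adj_next.
by rewrite adj_sym adj_next.
Qed.

Lemma sigma_bound_cycle m e n : 1 < m -> e <= 1 -> 3 * m <= n ->
  sigma_bound (cycle_graph (2 * m + e).+1) n (m * (2 * n - m - 1) + 2 * m * e + 2).
Proof.
move=> m2 e1 hn S [G real] big.
have degE (H : sgraph 'I_n) x : degree H x = deg_in H setT x.
  by apply: eq_card => y; rewrite !inE.
have dsE : deg_sum_in G setT = degree_sum S.
  by apply: eq_big => [x|x _]; rewrite ?inE // -degE.
have [||G' [p [[dG' _] cp]]] := @pot_cycle_main _ m e setT G m2 e1.
- by rewrite cardsT card_ord.
- rewrite cardsT card_ord dsE.
  have mE : m * (2 * n) = m * (2 * n - m - 1) + m * (m + 1) by rewrite -mulnDr; congr (_ * _); lia.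
  by move: (m * (2 * n - m - 1)) mE big => X mE big; lia.
by exists G'; [move=> i; rewrite dG' | apply: cycle_in_contains cp].
Qed.

(** * The extremal sequence *)

Definition split_rel m n : rel 'I_n := fun i j => (i != j) && ((i < m) || (j < m)).

Lemma split_rel_sym m n : symmetric (@split_rel m n).
Proof. by move=> i j; rewrite /split_rel eq_sym orbC. Qed.

Lemma split_rel_irr m n : irreflexive (@split_rel m n).
Proof. by move=> i; rewrite /split_rel eqxx. Qed.

Definition split_graph m n := SGraph (@split_rel_sym m n) (@split_rel_irr m n).

Definition split_seq m n : n.-tuple nat :=
  [tuple if i < m then n.-1 else m | i < n].

Lemma card_ord_lt m n : m <= n -> #|[set i : 'I_n | i < m]| = m.
Proof.
move=> mn; rewrite -sum1_card big_mkcond /=.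
under eq_bigr do rewrite inE.
by rewrite -big_mkcond (big_ord_narrow mn) sum1_card card_ord.
Qed.

Lemma split_seq_real m n : m <= n -> realization (split_seq m n) (split_graph m n).
Proof.
move=> mn i; rewrite tnth_mktuple /degree; case: ifP => im.
  rewrite -[n in RHS]card_ord -cardsT (cardsD1 i [set: _]) inE /=.
  by apply: eq_card => j; rewrite !inE /= /split_rel im andbT eq_sym andbT.
rewrite -[RHS](card_ord_lt mn); apply: eq_card => j; rewrite !inE /= /split_rel im /=.
by apply: andb_idl => jm; apply: contraFneq im => ->.
Qed.

Lemma split_seq_sum m n : m < n -> degree_sum (split_seq m n) = m * (2 * n - m - 1).
Proof.
move=> mn; rewrite /degree_sum; under eq_bigr do rewrite tnth_mktuple.
rewrite (bigID (fun i : 'I_n => i < m)) /=.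
rewrite (eq_bigr (fun=> n.-1)) => [|i ->//].
rewrite [X in _ + X](eq_bigr (fun=> m)) => [|i /negbTE->//].
have c1 : #|[pred i : 'I_n | i < m]| = m by rewrite -[RHS](card_ord_lt (ltnW mn)) cardsE.
have c2 := cardC [pred i : 'I_n | i < m]; rewrite c1 card_ord in c2.
rewrite !sum_nat_const c1 (_ : #|_| = n - m); last first.
  by rewrite -[in RHS]c2 addKn; apply: eq_card.
rewrite [_ * m]mulnC -mulnDr; congr (_ * _); lia.
Qed.

(** In any realization a vertex below [m] has degree [n - 1], hence sees all others; these [m]
    neighbours already exhaust the degree of each remaining vertex. *)
Lemma split_seq_unique m n (G : sgraph 'I_n) i j :
  m <= n -> realization (split_seq m n) G -> G i j -> (i < m) || (j < m).
Proof.
move=> mn real.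
have full (a b : 'I_n) : a < m -> b != a -> G a b.
  move=> am ba; have := real a; rewrite tnth_mktuple am /degree => dE.
  have sub : [set y | G a y] \subset [set~ a].
    by apply/subsetP=> y; rewrite !inE; apply: contraTneq => ->; rewrite adj_irr.
  have /setP/(_ b) : [set y | G a y] = [set~ a].
    apply/eqP; rewrite eqEcard sub dE cardsC1 card_ord leqnn //.
  by rewrite !inE ba.
case: (ltnP i m) => //= im ij.
have := real i; rewrite tnth_mktuple ltnNge im /= /degree -[RHS](card_ord_lt mn) => dE.
have sub : [set y : 'I_n | y < m] \subset [set y | G i y].
  apply/subsetP=> y; rewrite !inE => ym; rewrite adj_sym; apply: full => //.
  by apply: contraTneq ym => <-; rewrite -leqNgt.
have /setP/(_ j) : [set y : 'I_n | y < m] = [set y | G i y].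
  by apply/eqP; rewrite eqEcard sub dE leqnn.
by rewrite !inE ij.
Qed.

(** Each cycle edge has an end in [X], so [X] and its preimage under [ordS] would cover [2 * m + 1]
    indices with at most [2 * m]. *)
Lemma split_seq_no_cycle m n : 0 < m < n ->
  ~ potentially_graphical (cycle_graph (2 * m + 1)) (split_seq m n).
Proof.
case/andP=> m0 mn [G real [f finj fG]].
pose X := [set i | f i < m].
have Xm : #|X| <= m.
  rewrite -(card_imset _ finj) -[leqRHS](card_ord_lt (ltnW mn)).
  by apply/subset_leq_card/subsetP=> _ /imsetP[i iX ->]; move: iX; rewrite !inE.
have cover : [set: 'I_(2 * m + 1)] \subset X :|: @ordS _ @^-1: X.
  apply/subsetP=> i _; rewrite !inE; apply: (split_seq_unique (ltnW mn) real).
  apply: fG; rewrite /= /cycle_rel eqxx andbT -val_eqE /=.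
  have [lt_i|ge_i] := ltnP i.+1 (2 * m + 1); first by rewrite modn_small // neq_ltn ltnSn.
  have -> : i = 2 * m :> nat by have := ltn_ord i; lia.
  by rewrite addn1 modnn -lt0n muln_gt0.
have := leq_trans (subset_leq_card cover) (leq_card_setU _ _).1.
rewrite cardsT card_ord card_preimset; last exact: ordS_inj.
by move: Xm; move: #|X| => k; lia.
Qed.


(** * Existence of the minimum and the final statement *)

(** Descent to a smaller even bound as long as one exists, decided by excluded middle. *)
Lemma ex_is_sigma (U : finType) (H : sgraph U) n l :
  ~~ odd l -> sigma_bound H n l -> exists s, is_sigma H n s /\ s <= l.
Proof.
have [k] := ubnP l; elim: k l => // k IH l /ltnSE lk el bl.
have [[l' [l'l el' bl']]|min] := classic (exists l', [/\ l' < l, ~~ odd l' & sigma_bound H n l']).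
  have [s [sig sl]] := IH l' (leq_trans l'l lk) el' bl'.
  by exists s; split=> //; apply: leq_trans (ltnW l'l).
exists l; split=> //; split=> // l' el' bl'; rewrite leqNgt; apply/negP=> l'l.
by apply: min; exists l'.
Qed.


Theorem theorem3 (m n : nat) (hm : 2 <= m) (hn : 3 * m <= n) :
  is_sigma (cycle_graph (2 * m + 1)) n (m * (2 * n - m - 1) + 2) /\
  exists s : nat,
    is_sigma (cycle_graph (2 * m + 2)) n s /\
    s <= m * (2 * n - m - 1) + 2 * m + 2.
Proof.
have even_ext : ~~ odd (m * (2 * n - m - 1)).
  rewrite -subnDA addn1 oddM negb_and oddB; last by lia.
  by rewrite oddM /= negbK; case: (odd m).
have bound e := @sigma_bound_cycle m e n hm.
split; last first.
  have := bound 1 isT hn; rewrite muln1 (_ : (2 * m + 1).+1 = 2 * m + 2); last by lia.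
  move=> b; apply: (ex_is_sigma _ b).
  by rewrite addn2 /= negbK [2 * m]mul2n oddD odd_double addbF.
have := bound 0 isT hn; rewrite muln0 !addn0 (_ : (2 * m).+1 = 2 * m + 1); last by lia.
move=> b; split=> [|//|l' el' bl']; first by rewrite oddD (negbTE even_ext).
rewrite leqNgt; apply/negP=> lt_l'.
(* An even number below this even value plus 2 is at most the value itself, which is the degree sum
   of the extremal sequence. *)
have le_l' : l' <= m * (2 * n - m - 1).
  rewrite -ltnS ltn_neqAle; apply/andP; split; last by move: lt_l'; rewrite addn2 ltnS.
  by apply: contra el' => /eqP->; rewrite /= even_ext.
have mn : 0 < m < n by lia.
apply: (split_seq_no_cycle mn); apply: bl'; last by rewrite split_seq_sum //; case/andP: mn.
by exists (split_graph m n); apply: split_seq_real; lia.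
Qed.
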